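(* Let $p$ be a prime, let $H$ be a proper multiplicative subgroup of $\mathbb{F}_p^*$, and suppose $H=A+B$ with $A,B\subseteq\mathbb{F}_p$, where $|A|=|B|=\alpha\geq2$, $|H|=\alpha^2$, $p=r\alpha^2+1$ for an integer $r\geq2$, and $\sum_{a\in A}a=\sum_{b\in B}b=0$. Put $$F(X)=\prod_{b\in B}(X-b),\qquad G(X)=\prod_{a\in A}(X+a)\qquad\text{in }\mathbb{F}_p[X].$$ Then, in $\mathbb{F}_p[X]$, $$0=\alpha(3\alpha^2+4\alpha-1)\,(GF'''-FG''')-3(3\alpha^3-2\alpha^2-5\alpha+2)\,(G'F''-F'G'').$$
   Context: $\mathbb{F}_p$ is the finite field with $p$ elements, $\mathbb{F}_p^*=\mathbb{F}_p\setminus\{0\}$, and proper means $H\neq\mathbb{F}_p^*$. The sumset is $A+B=\{a+b:a\in A,\ b\in B\}$. Primes denote formal derivatives. Integers appearing as coefficients are interpreted in $\mathbb{F}_p$. *)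

(* Defs.v *)
From mathcomp Require Import all_boot all_order fingroup all_algebra.

Set Implicit Arguments.
Unset Strict Implicit.
Unset Printing Implicit Defensive.

Import GRing.Theory.
Local Open Scope ring_scope.

Definition sumset (V : finZmodType) (A B : {set V}) : {set V} :=
  [set a + b | a in A, b in B].

(* Main.v *)
Require Import Defs.
From mathcomp Require Import all_boot all_order fingroup all_algebra.
From mathcomp Require Import cyclic ring zify.

Set Implicit Arguments.
Unset Strict Implicit.
Unset Printing Implicit Defensive.

Import GRing.Theory.
Local Open Scope ring_scope.

(** Write n = alpha, s for the elements of B and t for the negatives of the
    elements of A, so that F and G are the monic polynomials with root sets s
    and t. The hypothesis A + B = H gives: x - y is an n^2-th root of unity
    for x in s and y in t. This is symmetric in s and t up to a sign, and the
    argument keeps the common value e of (x - y)^(n^2) arbitrary so that every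
    local statement can be used for (s, t) and for (t, s).

    Stepanov's method gives the rigidity. Let D = n^2 + n - 1 and consider
        f = sum over y in t of (X - y)^D / G'(y).
    The weights 1/G'(y) compute a divided difference, so they kill polynomials
    of degree less than n - 1. Read on the coefficients of f near infinity,
    this gives deg f <= n^2; read on its Taylor coefficients at b in s, where
    (b - y)^(n^2) = e, it shows that f minus a constant vanishes to order n at
    b. There are n such points, hence f = C F^n + c0 ([stepanov_power]).

    The Taylor coefficients of f of orders n, n + 1, n + 2 at b are divided
    differences of inverse powers of b - y, that is, binomial multiples of the
    first three Taylor coefficients of 1/G at b ([divdiff_inverse_powers]).
    Comparing them with those of C F^n gives, at each b in s, two relations
    between the derivatives of F and G ([contact_relations]).

    The first one is symmetric in F and G, so the polynomial
        n (F'' G + F G'') - 2 (n - 1) F' G'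
    vanishes at the 2n points of s and t; its degree is smaller than 2n, so it
    is zero ([second_order_identity]). Its derivative gives a third relation at
    b, and eliminating between the three relations shows that the polynomial of
    the theorem vanishes at b ([jet_elimination]). That polynomial is
    antisymmetric in F and G, so it also vanishes on t, and the same degree
    count makes it zero. All numerical factors that are cancelled are
    products of divisors of D!, which is nonzero modulo p because
    p = r n^2 + 1 > D. *)

(** * Divided differences *)

Definition root_poly (K : fieldType) (t : seq K) : {poly K} :=
  \prod_(y <- t) ('X - y%:P).

(** The divided difference of g at the nodes t, by its residue formula; the
    nodes are meant to be distinct. *)
Definition divdiff (K : fieldType) (t : seq K) (g : K -> K) : K :=
  \sum_(y <- t) g y / (root_poly t)^`().[y].

Lemma size_root_poly (K : fieldType) (t : seq K) :
  size (root_poly t) = (size t).+1.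
Proof. exact: size_prod_XsubC. Qed.

Lemma monic_root_poly (K : fieldType) (t : seq K) : root_poly t \is monic.
Proof. exact: monic_prod_XsubC. Qed.

Lemma root_root_poly (K : fieldType) (t : seq K) x :
  root (root_poly t) x = (x \in t).
Proof. exact: root_prod_XsubC. Qed.

Lemma root_poly_rem (K : fieldType) (t : seq K) y : y \in t ->
  root_poly t = ('X - y%:P) * root_poly (rem y t).
Proof. by move=> yt; rewrite /root_poly (perm_big _ (perm_to_rem yt)) big_cons. Qed.

Lemma deriv_root_poly (K : fieldType) (t : seq K) y : y \in t ->
  (root_poly t)^`().[y] = (root_poly (rem y t)).[y].
Proof.
move=> yt; rewrite (root_poly_rem yt) derivM derivB derivX derivC subr0.
by rewrite mul1r !hornerE subrr mul0r addr0.
Qed.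

Lemma deriv_root_poly_neq0 (K : fieldType) (t : seq K) y :
  uniq t -> y \in t -> (root_poly t)^`().[y] != 0.
Proof.
move=> ut yt; rewrite deriv_root_poly //.
by rewrite -[_ == 0]/(root _ y) root_root_poly mem_rem_uniq // inE eqxx.
Qed.

(** By Lagrange interpolation, q is the sum over the nodes y of
    q(y) / G'(y) * prod_(z != y) (X - z), and each of these products is monic of
    degree size t - 1. *)
Lemma divdiff_horner (K : fieldType) (t : seq K) (q : {poly K}) :
  uniq t -> (size q <= size t)%N ->
  divdiff t (fun y => q.[y]) = q`_(size t).-1.
Proof.
move=> ut sq.
pose G := root_poly t.
pose L := \sum_(y <- t) (q.[y] / G^`().[y]) *: root_poly (rem y t).
have szrem y : y \in t -> size (root_poly (rem y t)) = size t.
  move=> yt; rewrite size_root_poly size_rem //.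
  by case: (t) yt.
have qE : q = L.
  apply/eqP; rewrite -subr_eq0; apply/eqP/(@roots_geq_poly_eq0 _ _ t) => //.
    apply/allP=> x xt; rewrite rootE hornerD hornerN /L horner_sum.
    rewrite (bigD1_seq x) //= big1_seq ?addr0.
      by rewrite hornerZ -deriv_root_poly // divfK ?subrr ?deriv_root_poly_neq0.
    move=> y /andP[yx yt]; rewrite hornerZ (_ : (root_poly _).[x] = 0) ?mulr0 //.
    by apply/rootP; rewrite root_root_poly mem_rem_uniq // inE eq_sym yx.
  rewrite (leq_trans (size_polyD _ _)) // geq_max sq size_polyN /L.
  rewrite big_seq; apply: (leq_trans (size_sum _ _ _)).
  apply/bigmax_leqP_seq => y yt _; by rewrite (leq_trans (size_scale_leq _ _)) ?szrem.
rewrite [in RHS]qE /L coef_sum /divdiff big_seq [RHS]big_seq.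
apply: eq_bigr => y yt; rewrite coefZ -[in RHS](szrem y yt).
by rewrite -/(lead_coef _) (monicP (monic_root_poly _)) mulr1.
Qed.

(** The degree bound may be strict: then both sides are zero. *)
Lemma coef_top_shift (K : fieldType) (p : {poly K}) (c : K) (n : nat) :
  (size p <= n)%N -> (p \Po ('X - c%:P))`_n.-1 = p`_n.-1.
Proof.
have szC : size (p \Po ('X - c%:P)) = size p.
  by apply: size_comp_poly2; rewrite size_XsubC.
case: n => [|n] /=; first by rewrite leqn0 size_poly_eq0 => /eqP->; rewrite comp_poly0.
rewrite leq_eqVlt ltnS => /orP[/eqP szp|szp]; last by rewrite !nth_default ?szC.
have -> : n = (size p).-1 by rewrite szp.
rewrite -{1}szC -!/(lead_coef _) lead_coef_comp ?size_XsubC //.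
by rewrite lead_coefXsubC expr1n mulr1.
Qed.

Lemma divdiff_sum (K : fieldType) (t : seq K) I (r : seq I)
    (a : I -> K) (g : I -> K -> K) :
  divdiff t (fun y => \sum_(i <- r) a i * g i y)
    = \sum_(i <- r) a i * divdiff t (g i).
Proof.
rewrite /divdiff; under eq_bigr do rewrite mulr_suml.
rewrite exchange_big /=; apply: eq_bigr => i _; rewrite mulr_sumr.
by apply: eq_bigr => y _; rewrite mulrA.
Qed.

(** Since 1/G is the divided difference of y |-> 1/(X - y), the divided
    differences of (b - y)^-(k+1) are, up to sign, the Taylor coefficients of 1/G
    at b; the sum is the coefficient of order j in G * (1/G) = 1. The
    proof is independent of power series: divide the Taylor expansion of
    G at b by (y - b)^(j+1), evaluate at the roots y of G, and apply
    [divdiff_horner] to the polynomial part, whose top coefficient is the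
    leading coefficient of G when j = 0 and vanishes otherwise. *)
Lemma divdiff_inverse_powers (K : fieldType) (t : seq K) (b : K) (j : nat) :
  uniq t -> b \notin t -> (0 < size t)%N ->
  \sum_(i < j.+1) (-1) ^+ i * (root_poly t \Po ('X + b%:P))`_i
     * divdiff t (fun y => (b - y) ^- (j - i).+1) = (j == 0%N)%:R.
Proof.
move=> ut bt t0; set g := root_poly t \Po ('X + b%:P).
pose d := drop_poly j.+1 g \Po ('X - b%:P).
have szg : size g = (size t).+1.
  by rewrite size_comp_poly2 ?size_root_poly // size_XaddC.
have szd : (size (drop_poly j.+1 g) <= size t - j)%N.
  by rewrite size_drop_poly szg subSS.
have := @divdiff_horner _ t d ut.
rewrite size_comp_poly2 ?size_XsubC // => /(_ (leq_trans szd (leq_subr _ _))).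
rewrite coef_top_shift ?(leq_trans szd (leq_subr _ _)) // coef_drop_poly.
have -> : ((size t).-1 + j.+1)%N = (size t + j)%N by lia.
have -> : g`_(size t + j) = (j == 0%N)%:R.
  case: j {szd d} => [|j]; last by rewrite nth_default ?szg // -addSnnS leq_addr.
  rewrite addn0 -[size t]/((size t).+1.-1) -szg -/(lead_coef _) lead_coef_comp.
    rewrite (monicP (monic_root_poly _)) mul1r lead_coefDl.
      by rewrite lead_coefX expr1n.
    by rewrite size_polyX ltnS size_polyC_leq1.
  by rewrite size_XaddC.
(* At a root y of G the expansion of G at b vanishes, which expresses the
   polynomial quotient d by the truncated part of the expansion. *)
have dE y : y \in t -> d.[y] =
    (-1) ^+ j * \sum_(i < j.+1) (-1) ^+ i * g`_i * (b - y) ^- (j - i).+1.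
  move=> yt; have yb : b - y != 0.
    by rewrite subr_eq0; apply: contraNneq bt => ->.
  have := root_root_poly t y; rewrite yt => /rootP.
  have -> : root_poly t = g \Po ('X - b%:P) by rewrite comp_polyXaddC_K.
  have dyE : d.[y] = (drop_poly j.+1 g).[- (b - y)].
    by rewrite horner_comp hornerXsubC opprB.
  rewrite horner_comp -[in X in X = _](poly_take_drop j.+1 g) hornerD hornerM hornerXn.
  rewrite hornerXsubC -(opprB b y) -dyE (exprNn (b - y) j.+1) => /eqP.
  rewrite addr_eq0 => /eqP E.
  apply: (mulIf (expf_neq0 j.+1 yb)).
  have -> : d.[y] * (b - y) ^+ j.+1 =
      (-1) ^+ j * - (d.[y] * ((-1) ^+ j.+1 * (b - y) ^+ j.+1)).
    have := sqrr_sign K j; rewrite [(-1) ^+ j.+1]exprS; move: ((-1) ^+ j) => u u2.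
    by rewrite -[LHS]mul1r -{1}u2; ring.
  rewrite -E -mulrA; congr (_ * _).
  rewrite /take_poly horner_poly mulr_suml; apply: eq_bigr => i _.
  have -> : (b - y) ^+ j.+1 = (b - y) ^+ i * (b - y) ^+ (j - i).+1.
    by rewrite -exprD; congr (_ ^+ _); have := ltn_ord i; lia.
  rewrite (exprNn (b - y)) mulrCA -!mulrA; congr (_ * (_ * _)).
  by rewrite mulrCA mulVf ?mulr1 ?expf_neq0.
have -> : divdiff t (fun y => d.[y]) = (-1) ^+ j * \sum_(i < j.+1) (-1) ^+ i * g`_i *
   divdiff t (fun y => (b - y) ^- (j - i).+1).
  rewrite -divdiff_sum /divdiff mulr_sumr big_seq [RHS]big_seq.
  by apply: eq_bigr => y yt; rewrite dE // mulrA.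
case: j {szd d dE} => [|j] /= E; first by rewrite -E expr0 mul1r.
by apply/eqP; move/eqP: E; rewrite mulf_eq0 signr_eq0.
Qed.

(** * The Stepanov polynomial *)

Definition stepanov (K : fieldType) (t : seq K) (D : nat) : {poly K} :=
  \sum_(y <- t) (root_poly t)^`().[y]^-1 *: ('X - y%:P) ^+ D.

Lemma coef_XaddC_exp (K : fieldType) (c : K) (D k : nat) :
  (('X + c%:P) ^+ D)`_k = 'C(D, k)%:R * c ^+ (D - k).
Proof.
rewrite addrC exprDn coef_sum.
have [kD|Dk] := leqP k D; last first.
  rewrite bin_small // mul0r big1 // => i _.
  rewrite coefMn -polyC_exp coefCM coefXn (_ : (k == i) = false) ?mulr0 ?mul0rn //.
  by have := ltn_ord i; lia.
rewrite (bigD1 (Ordinal (kD : (k < D.+1)%N))) //= big1 ?addr0 => [|i /eqP ki].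
  by rewrite coefMn -polyC_exp coefCM coefXn eqxx mulr1 mulr_natl.
rewrite coefMn -polyC_exp coefCM coefXn (_ : (k == i) = false) ?mulr0 ?mul0rn //.
by apply/eqP => kiE; apply: ki; apply: val_inj.
Qed.

Lemma coef_stepanov_shift (K : fieldType) (t : seq K) (D : nat) (b : K) (k : nat) :
  (stepanov t D \Po ('X + b%:P))`_k
    = 'C(D, k)%:R * divdiff t (fun y => (b - y) ^+ (D - k)).
Proof.
rewrite /stepanov raddf_sum coef_sum /divdiff mulr_sumr; apply: eq_bigr => y _ /=.
rewrite comp_polyZ coefZ rmorphXn /= comp_polyB comp_polyX comp_polyC -addrA -polyCB.
by rewrite coef_XaddC_exp mulrC mulrA.
Qed.

(** The expected degree m + size t - 1 drops to m, because the coefficients of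
    order greater than m are divided differences of powers of y of exponent less
    than size t - 1. *)
Lemma size_stepanov (K : fieldType) (t : seq K) (m : nat) :
  uniq t -> (size (stepanov t (m + (size t).-1)) <= m.+1)%N.
Proof.
move=> ut; apply/leq_sizeP => k mk.
rewrite -[stepanov _ _]comp_polyXr -[X in _ \Po X]addr0 -polyC0 coef_stepanov_shift.
have [kD|Dk] := leqP k (m + (size t).-1); last by rewrite bin_small ?mul0r.
set l := (_ - k)%N.
rewrite (_ : divdiff _ _ = divdiff t (fun y => ((- 'X) ^+ l).[y])); last first.
  by apply: eq_bigr => y _; rewrite horner_exp hornerN hornerX sub0r.
have szl : size ((- 'X) ^+ l : {poly K}) = l.+1.
  by rewrite exprNn size_Msign size_polyXn.
have lt : (l < (size t).-1)%N by rewrite /l; lia.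
rewrite divdiff_horner ?szl //; last by lia.
by rewrite nth_default ?mulr0 // szl.
Qed.

Lemma dvdp_XsubC_exp_shift (K : fieldType) (p : {poly K}) (b : K) (n : nat) :
  (forall k, (k < n)%N -> (p \Po ('X + b%:P))`_k = 0) -> ('X - b%:P) ^+ n %| p.
Proof.
move=> p0; rewrite -[p](comp_polyXaddC_K _ b) -comp_Xn_poly; apply: dvdp_comp_poly.
rewrite -(poly_take_drop n (p \Po _)) (_ : take_poly n _ = 0) ?add0r ?dvdp_mulIr //.
by apply/polyP => k; rewrite coef_take_poly coef0; case: ltnP => // /p0.
Qed.

Lemma dvdp_root_poly_exp (K : fieldType) (s : seq K) (p : {poly K}) (n : nat) :
  uniq s -> (forall b, b \in s -> ('X - b%:P) ^+ n %| p) -> root_poly s ^+ n %| p.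
Proof.
elim: s => [|b s IHs] /=; first by rewrite /root_poly big_nil expr1n dvd1p.
move=> /andP[bs us] sp; rewrite /root_poly big_cons -/(root_poly s) exprMn.
rewrite Gauss_dvdp; last first.
  by apply/coprimep_expl/coprimep_expr;
    rewrite coprimep_sym coprimep_XsubC root_root_poly.
by rewrite sp ?mem_head // IHs // => c cs; rewrite sp // inE cs orbT.
Qed.

(** The Taylor coefficients of the Stepanov polynomial at b in s, of orders
    0 < k < n, are multiples of divided differences of (b - y)^(n-1-k), because
    (b - y)^(n^2) is the constant e; so they vanish. The constant term does not
    depend on b. Hence the n-th power of the root polynomial of s divides the
    difference, whose degree is at most n^2, so the quotient is a constant. *)
Lemma stepanov_power (K : fieldType) (s t : seq K) (n : nat) (e : K) :
  uniq s -> uniq t -> size s = n -> size t = n -> (0 < n)%N ->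
  (forall x y, x \in s -> y \in t -> (x - y) ^+ (n ^ 2) = e) ->
  exists C c0 : K, stepanov t (n ^ 2 + n.-1) = C *: root_poly s ^+ n + c0%:P.
Proof.
move=> us ut ss st n0 ste.
pose c0 := e * ((- 1) ^+ n.-1).
have [q Eq] : exists q, stepanov t (n ^ 2 + n.-1) - c0%:P = q * root_poly s ^+ n.
  apply/dvdpP; apply: dvdp_root_poly_exp => // b bs; apply: dvdp_XsubC_exp_shift => k kn.
  rewrite comp_polyB comp_polyC coefB coefC coef_stepanov_shift.
  set l := (n.-1 - k)%N.
  pose h : {poly K} := (- ('X - b%:P)) ^+ l.
  have hE : h = (-1) ^+ l *: ('X - b%:P) ^+ l.
    by rewrite /h (exprNn ('X - b%:P)) -mul_polyC polyC_exp polyCN.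
  have szh : size h = l.+1 by rewrite hE size_scale ?signr_eq0 // size_exp_XsubC.
  have ln : (l < n)%N by rewrite /l; lia.
  have -> : divdiff t (fun y => (b - y) ^+ (n ^ 2 + n.-1 - k)) = e * h`_n.-1.
    rewrite -st -divdiff_horner ?szh ?st // /divdiff mulr_sumr big_seq [RHS]big_seq.
    apply: eq_bigr => y yt; rewrite mulrA -(ste b y) //.
    rewrite horner_exp hornerN hornerXsubC opprB -exprD; congr (_ ^+ _ / _).
    by rewrite /l; lia.
  case: k @l @h kn hE szh ln => [|k] l h kn hE szh ln /=; last first.
    by rewrite nth_default ?szh ?mulr0 ?subr0 // /l; lia.
  have lE : l = n.-1 by rewrite /l subn0.
  have := monicP (monic_exp l (monicXsubC b)).
  rewrite /lead_coef size_exp_XsubC /= bin0 mul1r hE coefZ lE => ->.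
  by rewrite mulr1 subrr.
have szF : size (root_poly s ^+ n) = (n ^ 2).+1.
  rewrite -(prednK (_ : 0 < size (root_poly s ^+ n))%N).
    by rewrite size_exp size_root_poly ss mulnn.
  by rewrite size_poly_gt0 monic_neq0 ?monic_exp ?monic_root_poly.
have szq : (size q <= 1)%N.
  have [->|q0] := eqVneq q 0; first by rewrite size_poly0.
  have : (size (q * root_poly s ^+ n)%R <= (n ^ 2).+1)%N.
    have := size_stepanov (n ^ 2) ut; rewrite st => sz.
    rewrite -Eq (leq_trans (size_polyD _ _)) // geq_max sz /=.
    by rewrite size_polyN (leq_trans (size_polyC_leq1 _)).
  by rewrite size_Mmonic ?monic_exp ?monic_root_poly // szF; lia.
exists q`_0, c0; rewrite -mul_polyC -(size1_polyC szq) -Eq subrK //.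
Qed.

(** * Relations between derivatives at a single root *)

Lemma coef0_exp (K : fieldType) (P : {poly K}) n : (P ^+ n)`_0 = P`_0 ^+ n.
Proof. by rewrite -!horner_coef0 horner_exp. Qed.

Lemma coef1_exp (K : fieldType) (P : {poly K}) n :
  P`_0 * (P ^+ n)`_1 = n%:R * P`_0 ^+ n * P`_1.
Proof.
elim: n => [|n IHn]; first by rewrite expr0 coef1 /= !(mulr0, mul0r).
rewrite exprS coefM !big_ord_recl big_ord0 /= addr0 /bump /= coef0_exp mulrDr IHn.
by rewrite exprS -natr1; ring.
Qed.

Lemma coef2_exp (K : fieldType) (P : {poly K}) n :
  2 * P`_0 ^+ 2 * (P ^+ n)`_2
    = P`_0 ^+ n * (2 * n%:R * P`_0 * P`_2 + n%:R * (n%:R - 1) * P`_1 ^+ 2).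
Proof.
elim: n => [|n IHn]; first by rewrite expr0 coef1 /=; ring.
rewrite (exprS P) coefM !big_ord_recl big_ord0 /= addr0 /bump /= coef0_exp.
have := coef1_exp P n; rewrite (exprS P`_0 n) -[n.+1%:R]natr1; move: IHn.
move: (P ^+ n)`_1 (P ^+ n)`_2 (P`_0) (P`_1) (P`_2) n%:R (P`_0 ^+ n).
move=> u v x y z N w E2 E1.
transitivity (x * (2 * x ^+ 2 * v) + 2 * x * y * (x * u) + 2 * x ^+ 2 * z * w).
  by ring.
by rewrite E1 E2; ring.
Qed.

Lemma derivn_shift (K : fieldType) (p : {poly K}) (b : K) k :
  (p \Po ('X + b%:P))^`(k) = p^`(k) \Po ('X + b%:P).
Proof.
elim: k => [|k IHk] //; rewrite !derivnS IHk deriv_comp.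
by rewrite derivD derivX derivC addr0 mulr1.
Qed.

Lemma coef_shift (K : fieldType) (p : {poly K}) (b : K) k :
  (p \Po ('X + b%:P))`_k *+ k`! = p^`(k).[b].
Proof.
have := coef_derivn k (p \Po ('X + b%:P)) 0.
rewrite derivn_shift addn0 ffactnn => <-.
by rewrite -horner_coef0 horner_comp !hornerE.
Qed.

(** One hypothesis D! != 0 provides the invertibility of every small integer
    that has to be cancelled. *)
Lemma natr_fact_neq0 (K : fieldType) (D k : nat) :
  D`!%:R != 0 :> K -> (k %| D`!)%N -> k%:R != 0 :> K.
Proof.
by move=> D0 /dvdnP[q E]; apply: contraNneq D0 => k0; rewrite E natrM k0 mulr0.
Qed.

(** At b in s write F = (X - b) Q, so that the Taylor coefficient of order n + j
    of C F^n is C times the coefficient of order j of Q^n. It equals e times a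
    binomial coefficient times a Taylor coefficient of 1/G. Taking the quotients
    of the cases j = 1 and j = 2 by the case j = 0 eliminates C and e, and the
    ratios of the binomial coefficients are n - 1 and
    (n - 1)(n^2 - 2)/(n + 2). *)
Lemma contact_relations (K : fieldType) (s t : seq K) (n : nat) (e b : K) :
  uniq s -> uniq t -> size s = n -> size t = n -> (1 < n)%N ->
  e != 0 -> (n ^ 2 + n.-1)`!%:R != 0 :> K ->
  (forall x y, x \in s -> y \in t -> (x - y) ^+ (n ^ 2) = e) -> b \in s ->
  let F := root_poly s in let G := root_poly t in let N : K := n%:R in
     N * F^`(2).[b] * G.[b] = 2 * (N - 1) * F^`().[b] * G^`().[b]
  /\ (N + 2) * (4 * N * F^`().[b] * F^`(3).[b]
                + 3 * N * (N - 1) * F^`(2).[b] ^+ 2) * G.[b] ^+ 2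
     = 12 * (N - 1) * (N ^+ 2 - 2)
         * (2 * G^`().[b] ^+ 2 - G.[b] * G^`(2).[b]) * F^`().[b] ^+ 2.
Proof.
move=> us ut ss st n1 e0 D0 ste bs F G N; set D := (n ^ 2 + n.-1)%N in D0.
have bt : b \notin t.
  apply: contraNN e0 => bt; rewrite -(ste b b) // subrr expr0n.
  by rewrite expn_eq0 (_ : (n == 0%N) = false) //; lia.
have n0 : (0 < n)%N by lia.
have [C [c0 fE]] := stepanov_power us ut ss st n0 ste.
pose S j := divdiff t (fun y => (b - y) ^- j.+1).
pose Q := root_poly (rem b s) \Po ('X + b%:P).
pose g := G \Po ('X + b%:P).
have FQ : F \Po ('X + b%:P) = 'X * Q.
  by rewrite /F (root_poly_rem bs) comp_polyM comp_polyB comp_polyX comp_polyC addrK.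
have contact j : (j < 3)%N -> C * (Q ^+ n)`_j = 'C(D, n + j)%:R * e * S j.
  move=> j3; have := coef_stepanov_shift t D b (n + j).
  rewrite fE comp_polyD comp_polyZ comp_polyC rmorphXn /= FQ exprMn coefD coefC.
  rewrite addn_eq0 (_ : (n == 0%N) = false) /=; last by lia.
  rewrite addr0 coefZ ['X^n * _]mulrC coefMXn ltnNge leq_addr /= addKn => ->.
  rewrite -mulrA; congr (_ * _).
  rewrite /S /divdiff mulr_sumr big_seq [RHS]big_seq; apply: eq_bigr => y yt.
  have yb : b - y != 0 by rewrite subr_eq0; apply: contraNneq bt => ->.
  rewrite mulrA -(ste b y) //; congr (_ / _).
  have -> : (n ^ 2 = (D - (n + j)) + j.+1)%N by rewrite /D; nia.
  by rewrite exprD mulfK ?expf_neq0.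
have t0 : (0 < size t)%N by rewrite st.
have S0 : g`_0 * S 0%N = 1.
  have := divdiff_inverse_powers 0 ut bt t0.
  by rewrite big_ord_recl big_ord0 /= addr0 expr0 mul1r.
have S1 : g`_0 * S 1%N = g`_1 * S 0%N.
  have := divdiff_inverse_powers 1 ut bt t0.
  rewrite !big_ord_recl big_ord0 /= -/g -/(S 1%N) -/(S 0%N) => E.
  by apply: subr0_eq; apply: etrans E; ring.
have S2 : g`_0 * S 2%N = g`_1 * S 1%N - g`_2 * S 0%N.
  have := divdiff_inverse_powers 2 ut bt t0.
  rewrite !big_ord_recl big_ord0 /= -/g -/(S 2%N) -/(S 1%N) -/(S 0%N) => E.
  by apply: subr0_eq; apply: etrans E; ring.
have B0 : 'C(D, n)%:R != 0 :> K.
  apply: natr_fact_neq0 D0 _; rewrite -(@bin_fact D n) ?dvdn_mulr //.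
  by rewrite /D; nia.
have B1 : 'C(D, n.+1)%:R = (N - 1) * 'C(D, n)%:R.
  rewrite (_ : N - 1 = (n - 1)%:R) -?natrM; last by rewrite natrB.
  congr (_ %:R); apply/eqP.
  rewrite -(eqn_pmul2l (ltn0Sn n)) mul_bin_left mulnA; apply/eqP.
  by congr (_ * _)%N; rewrite /D; nia.
have B2 : (N + 2) * 'C(D, n.+2)%:R = (N ^+ 2 - 2) * 'C(D, n.+1)%:R.
  rewrite /N -natrX -natrB ?expn_gt0; last by nia.
  rewrite -natrD -!natrM; congr (_ %:R); rewrite addn2 mul_bin_left; congr (_ * _)%N.
  by rewrite /D; nia.
have F1 : F^`().[b] = Q`_0.
  by rewrite -[F^`()]/(F^`(1)) -coef_shift FQ coefXM.
have F2 : F^`(2).[b] = 2 * Q`_1 by rewrite -coef_shift FQ coefXM mulr_natl.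
have F3 : F^`(3).[b] = 6 * Q`_2 by rewrite -coef_shift FQ coefXM mulr_natl.
have G0 : G.[b] = g`_0 by rewrite -[G]/(G^`(0)) -coef_shift.
have G1 : G^`().[b] = g`_1 by rewrite -[G^`()]/(G^`(1)) -coef_shift.
have G2 : G^`(2).[b] = 2 * g`_2 by rewrite -coef_shift mulr_natl.
rewrite {}F1 {}F2 {}F3 {}G0 {}G1 {}G2.
have := contact 0%N isT; have := contact 1%N isT; have := contact 2%N isT.
rewrite addn0 addn1 addn2 coef0_exp.
have := coef1_exp Q n; have := coef2_exp Q n; rewrite -/N.
move: B1 B2 B0 S0 S1 S2; rewrite {contact}.
move: (S 0%N) (S 1%N) (S 2%N) (g`_0) (g`_1) (g`_2) (Q`_0) (Q`_1) (Q`_2).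
move=> S0 S1 S2 g0 g1 g2 q0 q1 q2.
move: (Q ^+ n)`_1 (Q ^+ n)`_2 (q0 ^+ n) => u v w.
move: N 'C(D, n)%:R 'C(D, n.+1)%:R 'C(D, n.+2)%:R => N B0 B1 B2.
move=> EB1 EB2 B0n ES0 ES1 ES2 Ev Eu C2 C1 C0.
have Be : B0 * e != 0 by rewrite mulf_neq0.
(* The two relations in terms of the Taylor coefficients: g0 * S0 = 1 is
   inserted so that e B0 S0 = C Q(0)^n can be used, which removes C. *)
have two : N * q1 * g0 = (N - 1) * q0 * g1.
  apply: (mulfI Be).
  transitivity (N * q1 * g0 ^+ 2 * (B0 * e * S0)).
    by rewrite -[LHS]mulr1 -[X in _ * X = _]ES0; ring.
  rewrite -C0
    [LHS](_ : _ = C * g0 ^+ 2 * (N * w * q1)); last by ring.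
  rewrite -Eu
    [LHS](_ : _ = g0 ^+ 2 * q0 * (C * u)); last by ring.
  rewrite C1 EB1
    [LHS](_ : _ = (N - 1) * B0 * e * q0 * g0 * (g0 * S1)); last by ring.
  rewrite ES1
    [LHS](_ : _ = (N - 1) * B0 * e * q0 * g1 * (g0 * S0)); last by ring.
  by rewrite ES0; ring.
have three : (N + 2) * (2 * N * q0 * q2 + N * (N - 1) * q1 ^+ 2) * g0 ^+ 2
    = 2 * (N - 1) * (N ^+ 2 - 2) * (g1 ^+ 2 - g0 * g2) * q0 ^+ 2.
  apply: (mulfI Be).
  transitivity ((N + 2) * g0 ^+ 3 * (B0 * e * S0)
      * (2 * N * q0 * q2 + N * (N - 1) * q1 ^+ 2)).
    by rewrite -[LHS]mulr1 -[X in _ * X = _]ES0; ring.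
  rewrite -C0
    [LHS](_ : _ = C * (N + 2) * g0 ^+ 3 * (w *
      (2 * N * q0 * q2 + N * (N - 1) * q1 ^+ 2))); last by ring.
  rewrite -Ev
    [LHS](_ : _ = 2 * (N + 2) * g0 ^+ 3 * q0 ^+ 2 * (C * v)); last by ring.
  rewrite C2
    [LHS](_ : _ = 2 * g0 ^+ 2 * q0 ^+ 2 * e * ((N + 2) * B2) * (g0 * S2)); last by ring.
  rewrite EB2 EB1 ES2
    [LHS](_ : _ = 2 * g0 * q0 ^+ 2 * e * ((N ^+ 2 - 2) * ((N - 1) * B0))
      * (g1 * (g0 * S1) - g0 * g2 * S0)); last by ring.
  rewrite ES1
    [LHS](_ : _ = 2 * q0 ^+ 2 * e * ((N ^+ 2 - 2) * ((N - 1) * B0))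
      * (g1 ^+ 2 - g0 * g2) * (g0 * S0)); last by ring.
  by rewrite ES0; ring.
split.
  by transitivity (2 * (N * q1 * g0)); [ring | rewrite two; ring].
transitivity (12 * ((N + 2) * (2 * N * q0 * q2 + N * (N - 1) * q1 ^+ 2) * g0 ^+ 2)); first by ring.
by rewrite three; ring.
Qed.

(** * Global identities *)

Lemma poly_eq0_of_two_root_sets (K : fieldType) (s t : seq K) (p : {poly K}) :
  uniq s -> uniq t -> {in s, forall x, x \notin t} ->
  {in s, forall x, p.[x] = 0} -> {in t, forall x, p.[x] = 0} ->
  (size p <= size s + size t)%N -> p = 0.
Proof.
move=> us ut st ps pt szp; apply: (@roots_geq_poly_eq0 _ _ (s ++ t)).
- apply/allP => x; rewrite mem_cat => /orP[xs|xt]; apply/rootP.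
    exact: ps.
  exact: pt.
- rewrite cat_uniq us ut andbT /=; apply/hasPn => x xt /=.
  by apply/negP => /st; rewrite xt.
- by rewrite size_cat.
Qed.

Lemma size_derivn_leq (K : fieldType) (p : {poly K}) k :
  (size p^`(k) <= size p - k)%N.
Proof.
elim: k => [|k IHk]; first by rewrite subn0.
rewrite derivnS; have [->|p0] := eqVneq p^`(k) 0; first by rewrite deriv0 size_poly0.
by have := lt_size_deriv p0; lia.
Qed.

Lemma size_derivn_mul (K : fieldType) (s t : seq K) (i j : nat) :
  (0 < i + j)%N ->
  (size ((root_poly s)^`(i) * (root_poly t)^`(j))%R <= size s + size t)%N.
Proof.
move=> ij; apply: (leq_trans (size_polyMleq _ _)).
have := size_derivn_leq (root_poly s) i; have := size_derivn_leq (root_poly t) j.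
by rewrite !size_root_poly; lia.
Qed.

Lemma power_difference_sym (K : fieldType) (s t : seq K) (m : nat) (e : K) :
  (forall x y, x \in s -> y \in t -> (x - y) ^+ m = e) ->
  forall x y, x \in t -> y \in s -> (x - y) ^+ m = (-1) ^+ m * e.
Proof. by move=> ste x y xt ys; rewrite -opprB (exprNn (y - x)) ste. Qed.

Lemma disjoint_of_power_difference (K : fieldType) (s t : seq K) (n : nat) (e : K) :
  e != 0 -> (forall x y, x \in s -> y \in t -> (x - y) ^+ (n ^ 2) = e) ->
  (0 < n)%N -> {in s, forall x, x \notin t}.
Proof.
move=> e0 ste n0 x xs; apply: contraNN e0 => xt.
by rewrite -(ste x x) // subrr expr0n expn_eq0 eqn0Ngt n0.
Qed.

(** The difference of the two sides has degree at most 2n - 2. It vanishes on s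
    by [contact_relations], and on t by the same relations for (t, s), because it
    is symmetric in F and G. *)
Lemma second_order_identity (K : fieldType) (s t : seq K) (n : nat) (e : K) :
  uniq s -> uniq t -> size s = n -> size t = n -> (1 < n)%N ->
  e != 0 -> (n ^ 2 + n.-1)`!%:R != 0 :> K ->
  (forall x y, x \in s -> y \in t -> (x - y) ^+ (n ^ 2) = e) ->
  let F := root_poly s in let G := root_poly t in
  n%:R *: (F^`(2) * G + F * G^`(2)) = (2 * (n%:R - 1)) *: (F^`() * G^`()).
Proof.
move=> us ut ss st n1 e0 D0 ste F G.
have ste' := power_difference_sym ste.
have e0' : (-1) ^+ (n ^ 2) * e != 0 by rewrite mulf_neq0 ?signr_eq0.
have nst := disjoint_of_power_difference e0 ste (ltnW n1).
apply: subr0_eq; apply: (@poly_eq0_of_two_root_sets _ s t) => // [x xs|x xt|].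
- have [E _] := contact_relations us ut ss st n1 e0 D0 ste xs.
  have F0 : F.[x] = 0 by apply/rootP; rewrite root_root_poly.
  move/eqP: E; rewrite -subr_eq0 -/F -/G => /eqP E; apply: etrans E.
  by rewrite !hornerE /= F0; ring.
- have [E _] := contact_relations ut us st ss n1 e0' D0 ste' xt.
  have G0 : G.[x] = 0 by apply/rootP; rewrite root_root_poly.
  move/eqP: E; rewrite -subr_eq0 -/F -/G => /eqP E; apply: etrans E.
  by rewrite !hornerE /= G0; ring.
- have small i j c : (0 < i + j)%N ->
      (size (c *: (F^`(i) * G^`(j)))%R <= size s + size t)%N.
    by move=> ij; rewrite (leq_trans (size_scale_leq _ _)) // size_derivn_mul.
  rewrite (leq_trans (size_polyD _ _)) // geq_max size_polyN scalerDr.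
  rewrite (leq_trans (size_polyD _ _)) /= ?geq_max; first exact: (small 1 1)%N.
  by rewrite (small 2 0)%N // (small 0 2)%N.
Qed.

Definition third_order_form (K : fieldType) (N : K) (F G : {poly K}) : {poly K} :=
  (N * (3 * N ^+ 2 + 4 * N - 1)) *: (G * F^`(3) - F * G^`(3))
  - (3 * (3 * N ^+ 3 - 2 * N ^+ 2 - 5 * N + 2)) *: (G^`() * F^`(2) - F^`() * G^`(2)).

Lemma third_order_form_swap (K : fieldType) (N : K) (F G : {poly K}) :
  third_order_form N G F = - third_order_form N F G.
Proof. by rewrite /third_order_form -!mul_polyC; ring. Qed.

(** Here fi and gi stand for the i-th derivatives of F and G at a root of F. The
    first two relations express f2 and f3 by the other quantities; substituted
    in the third one they give a linear relation Z = 0 between g2 g0 and g1^2,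
    and substituted in the conclusion they give a multiple of the same Z. The
    coefficients of the conclusion are the ones for which this happens. Stating
    Z with cleared denominators matters, since its coefficients may be zero in
    positive characteristic. *)
Lemma jet_elimination (K : fieldType) (N f1 f2 f3 g0 g1 g2 : K) :
  N != 0 -> 2 != 0 :> K -> f1 != 0 -> g0 != 0 ->
  N * f2 * g0 = 2 * (N - 1) * f1 * g1 ->
  N * f3 * g0 = (N - 2) * (f2 * g1 + f1 * g2) ->
  (N + 2) * (4 * N * f1 * f3 + 3 * N * (N - 1) * f2 ^+ 2) * g0 ^+ 2
    = 12 * (N - 1) * (N ^+ 2 - 2) * (2 * g1 ^+ 2 - g0 * g2) * f1 ^+ 2 ->
  N * (3 * N ^+ 2 + 4 * N - 1) * (g0 * f3)
    - 3 * (3 * N ^+ 3 - 2 * N ^+ 2 - 5 * N + 2) * (g1 * f2 - f1 * g2) = 0.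
Proof.
move=> N0 two0 f10 g00 E2 E3 B.
have Ng0 : N * g0 != 0 by rewrite mulf_neq0.
have f2E : f2 = 2 * (N - 1) * f1 * g1 / (N * g0).
  by rewrite -E2; field; rewrite N0 g00.
have f3E : f3 = (N - 2) * (f2 * g1 + f1 * g2) / (N * g0).
  by rewrite -E3; field; rewrite N0 g00.
pose Z := N * (3 * N ^+ 3 - 2 * N ^+ 2 - 6 * N + 2) * (g2 * g0)
          - (N - 1) ^+ 2 * (N + 1) * (3 * N - 2) * g1 ^+ 2.
have Z0 : Z = 0.
  have c0 : 2 * 2 * f1 ^+ 2 / N != 0 by rewrite !mulf_neq0 ?invr_neq0 ?expf_neq0.
  apply: (mulfI c0); rewrite mulr0.
  move/eqP: B; rewrite -subr_eq0 => /eqP B; apply: etrans B.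
  by rewrite f3E f2E /Z; field; rewrite N0 g00.
transitivity (4 * f1 / (N * g0) * Z); last by rewrite Z0 mulr0.
by rewrite f3E f2E /Z; field; rewrite N0 g00.
Qed.

(** At a root of F the derivative of [second_order_identity] complements the two
    contact relations. *)
Lemma third_order_form_root (K : fieldType) (s t : seq K) (n : nat) (e b : K) :
  uniq s -> uniq t -> size s = n -> size t = n -> (1 < n)%N ->
  e != 0 -> (n ^ 2 + n.-1)`!%:R != 0 :> K ->
  (forall x y, x \in s -> y \in t -> (x - y) ^+ (n ^ 2) = e) -> b \in s ->
  (third_order_form n%:R (root_poly s) (root_poly t)).[b] = 0.
Proof.
move=> us ut ss st n1 e0 D0 ste bs.
have [A B] := contact_relations us ut ss st n1 e0 D0 ste bs.
have := congr1 (fun p => p^`().[b]) (second_order_identity us ut ss st n1 e0 D0 ste).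
have n_neq0 : n%:R != 0 :> K by apply: natr_fact_neq0 D0 (dvdn_fact _); nia.
have two_neq0 : 2 != 0 :> K by apply: natr_fact_neq0 D0 (dvdn_fact _); nia.
have F'0 : (root_poly s)^`().[b] != 0 by rewrite deriv_root_poly_neq0.
have G0 : (root_poly t).[b] != 0.
  rewrite -[_ == 0]/(root _ b) root_root_poly.
  exact: disjoint_of_power_difference e0 ste (ltnW n1) _ bs.
have F0 : (root_poly s).[b] = 0 by apply/rootP; rewrite root_root_poly.
rewrite !(derivZ, derivD, derivM) /third_order_form !hornerE /= F0.
move: A B F'0 G0; rewrite /derivn /= => A B F'0 G0 E.
rewrite !mul0r subr0; apply: etrans (jet_elimination n_neq0 two_neq0 F'0 G0 A _ B).
  by ring.
apply: subr0_eq; move/eqP: E; rewrite -subr_eq0 => /eqP E; apply: etrans E.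
by ring.
Qed.

Lemma third_order_form_eq0 (K : fieldType) (s t : seq K) (n : nat) (e : K) :
  uniq s -> uniq t -> size s = n -> size t = n -> (1 < n)%N ->
  e != 0 -> (n ^ 2 + n.-1)`!%:R != 0 :> K ->
  (forall x y, x \in s -> y \in t -> (x - y) ^+ (n ^ 2) = e) ->
  third_order_form n%:R (root_poly s) (root_poly t) = 0.
Proof.
move=> us ut ss st n1 e0 D0 ste.
have ste' := power_difference_sym ste.
have e0' : (-1) ^+ (n ^ 2) * e != 0 by rewrite mulf_neq0 ?signr_eq0.
apply: (@poly_eq0_of_two_root_sets _ s t) => // [x xs|x xs|x xt|].
- exact: disjoint_of_power_difference e0 ste (ltnW n1) _ xs.
- exact: third_order_form_root us ut ss st n1 e0 D0 ste xs.
- rewrite third_order_form_swap hornerN.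
  by rewrite (third_order_form_root ut us st ss n1 e0' D0 ste' xt) oppr0.
rewrite /third_order_form -![root_poly t * _]mulrC -![(root_poly t)^`() * _]mulrC.
have small i j : (0 < i + j)%N ->
    (size ((root_poly s)^`(i) * (root_poly t)^`(j))%R <= size s + size t)%N.
  exact: size_derivn_mul.
rewrite (leq_trans (size_polyD _ _)) // geq_max size_polyN.
rewrite !(leq_trans (size_scale_leq _ _)) //.
  rewrite (leq_trans (size_polyD _ _)) // geq_max size_polyN.
  by rewrite (small 2 1)%N // (small 1 2)%N.
rewrite (leq_trans (size_polyD _ _)) // geq_max size_polyN.
by rewrite (small 3 0)%N // (small 0 3)%N.
Qed.

(** * Sumsets equal to a multiplicative subgroup *)

Lemma prime_ndvd_fact (p D : nat) : prime p -> (D < p)%N -> ~~ (p %| D`!)%N.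
Proof.
move=> pp; elim: D => [|D IHD] Dp; first by rewrite fact0 gtnNdvd // prime_gt1.
by rewrite factS Euclid_dvdM // negb_or gtnNdvd // IHD // ltnW.
Qed.

Theorem proposition2p10 (p : nat) (p_prime : prime p)
    (H : {group {unit 'F_p}}) (H_proper : H \proper [set: {unit 'F_p}])
    (A B : {set 'F_p}) (H_sum : [set val u | u in H] = sumset A B)
    (alpha : nat) (alpha_ge2 : (2 <= alpha)%N)
    (cardA : #|A| = alpha) (cardB : #|B| = alpha)
    (cardH : #|H| = (alpha ^ 2)%N)
    (r : nat) (r_ge2 : (2 <= r)%N) (p_eq : p = (r * alpha ^ 2 + 1)%N)
    (sumA : \sum_(a in A) a = 0) (sumB : \sum_(b in B) b = 0) :
  let F : {poly 'F_p} := \prod_(b in B) ('X - b%:P) in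
  let G : {poly 'F_p} := \prod_(a in A) ('X + a%:P) in
  let n : int := Posz alpha in
  0 = (n * (3 * n ^+ 2 + 4 * n - 1))%:~R *: (G * F^`(3) - F * G^`(3))
      - (3 * (3 * n ^+ 3 - 2 * n ^+ 2 - 5 * n + 2))%:~R
          *: (G^`() * F^`(2) - F^`() * G^`(2)).
Proof.
move=> F G n.
pose s := enum B; pose t := map -%R (enum A).
have FE : F = root_poly s by rewrite /F /root_poly big_enum.
have GE : G = root_poly t.
  rewrite /G /root_poly big_map big_enum; apply: eq_bigr => a _.
  by rewrite polyCN opprK.
have us : uniq s by rewrite enum_uniq.
have ut : uniq t by rewrite map_inj_uniq ?enum_uniq //; apply: oppr_inj.
have ss : size s = alpha by rewrite /s -cardE.
have st : size t = alpha by rewrite /t size_map -cardE.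
have fact_neq0 : (alpha ^ 2 + alpha.-1)`!%:R != 0 :> 'F_p.
  rewrite -(dvdn_pcharf (pchar_Fp p_prime)) prime_ndvd_fact //.
  by nia.
have H_roots x y : x \in s -> y \in t -> (x - y) ^+ (alpha ^ 2) = 1.
  rewrite mem_enum => xB /mapP[a]; rewrite mem_enum => aA ->; rewrite opprK.
  have : a + x \in sumset A B by apply/imset2P; exists a x.
  rewrite -H_sum => /imsetP[u uH]; rewrite addrC => ->.
  have uH1 : (u ^+ (alpha ^ 2))%g = 1%g.
    by apply/eqP; rewrite -order_dvdn -cardH order_dvdG.
  by rewrite -FinRing.val_unitX uH1.
have := third_order_form_eq0 us ut ss st alpha_ge2 (oner_neq0 _) fact_neq0 H_roots.
rewrite -FE -GE /third_order_form => <-.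
rewrite !(rmorphM, rmorphB, rmorphD, rmorphXn) /=.
by [].
Qed.
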